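(* Let $X$ be a complete $c_X$-quasiconvex metric space and $Y$ a complete $c_Y$-quasiconvex metric space. Let $G\subsetneq X$ be a domain, let $G'\subsetneq Y$ be a $c_1$-quasiconvex domain, and let $f:G\to G'$ be a homeomorphism such that $f$ is weakly $H_1$-quasisymmetric and $f^{-1}:G'\to G$ is weakly $H_2$-quasisymmetric. If $D\subset G$ is a $b$-uniform subdomain, then $D'=f(D)$ is $b'$-uniform, where the constant $b'$ depends only on $c_X$, $c_Y$, $c_1$, $b$, $H_1$ and $H_2$.
   Context: The distance between points $x,y$ of a metric space is written $|x-y|$. A domain is a nonempty open connected subset. For a domain $D\subsetneq X$ in a connected metric space $X$ (so that $\partial D\neq\emptyset$), $\delta_D(z)$ denotes the distance from $z\in D$ to the boundary $\partial D$. $\ell(\gamma)$ denotes the length of an arc $\gamma$, and $\gamma[x,z]$ denotes the part of $\gamma$ between $x$ and $z$. A metric space $Z$ is $c$-quasiconvex ($c\ge 1$) if each pair of points $x,y\in Z$ can be joined by an arc $\gamma$ in $Z$ with $\ell(\gamma)\le c|x-y|$; a domain is $c$-quasiconvex if it is so as a metric space with the restricted metric. A homeomorphism $f$ between metric spaces is weakly $H$-quasisymmetric if $|x-a|\le |x-b|$ implies $|f(x)-f(a)|\le H|f(x)-f(b)|$ for each triple $x,a,b$ of points of its domain of definition. (Subdomains carry the restricted metric.) A domain $D\subsetneq X$ is $b$-uniform if each pair of points $x,y\in D$ can be joined by a rectifiable arc $\gamma$ in $D$ such that (1) $\min\{\ell(\gamma[x,z]),\ell(\gamma[z,y])\}\le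 b\,\delta_D(z)$ for all $z\in\gamma$, and (2) $\ell(\gamma)\le b|x-y|$. *)

(* Defs.v *)
From HB Require Import structures.
From mathcomp Require Import all_boot all_order all_algebra.
From mathcomp Require Import all_classical all_reals all_analysis.

Set Implicit Arguments.
Unset Strict Implicit.
Unset Printing Implicit Defensive.

Import Order.TTheory GRing.Theory Num.Theory.
Import numFieldNormedType.Exports.

Local Open Scope classical_set_scope.
Local Open Scope ring_scope.

(* The library's [Complete] requires a base point; this is no restriction for
   spaces that contain a domain, since domains are nonempty. *)
#[short(type="completeMetricType")]
HB.structure Definition CompleteMetric (R : numDomainType) :=
  {T of Complete T & Metric R T}.

Section Arcs.
Context {R : realType} {X : metricType R}.
Implicit Types (a b : R) (gam : R -> X) (A : set X) (x y : X).

(* Metric analogue of [variation]; [s] lists the points of the subdivision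
   other than [a]. *)
Definition path_variation a b gam (s : seq R) : R :=
  let F := gam \o nth b (a :: s) in
  \sum_(0 <= n < size s) mdist (F n) (F n.+1).

Definition path_length a b gam : \bar R :=
  ereal_sup [set (path_variation a b gam s)%:E | s in itv_partition a b].

Definition rectifiable a b gam : Prop := (path_length a b gam < +oo)%E.

(* An arc is given by an injective continuous parametrization of a compact
   interval [a, b]. The case a = b is allowed, so that a point is joined to
   itself by a degenerate arc of length 0. As the parametrization is injective,
   the subarc between [gam s] and [gam t] is the restriction of [gam] to
   [s, t], and its length is [path_length s t gam]. *)
Definition arc_joining A x y a b gam : Prop :=
  [/\ a <= b, {within `[a, b], continuous gam}, {in `[a, b] &, injective gam},
      (forall t, t \in `[a, b] -> A (gam t)) & gam a = x /\ gam b = y].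

Definition quasiconvex (c : R) A : Prop :=
  1 <= c /\
  forall x y, A x -> A y ->
    exists a b gam, arc_joining A x y a b gam /\
      (path_length a b gam <= (c * mdist x y)%:E)%E.

End Arcs.

Section Domains.
Context {R : realType} {X : metricType R}.
Implicit Types (D : set X) (x y z : X).

Definition domain D : Prop := [/\ open D, D !=set0 & connected D].

Definition boundary D : set X := closure D `\` D°.

Definition bdist D z : R := inf [set mdist z w | w in boundary D].

Definition uniform (b : R) D : Prop :=
  [/\ domain D, D `<` setT &
      forall x y, D x -> D y ->
      exists s t gam,
        [/\ arc_joining D x y s t gam, rectifiable s t gam,
            (forall u, u \in `[s, t] ->
               (Order.min (path_length s u gam) (path_length u t gam)
                  <= (b * bdist D (gam u))%:E)%E) &
            (path_length s t gam <= (b * mdist x y)%:E)%E]].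

End Domains.

Section Maps.
Context {R : realType} {X Y : metricType R}.

(* Maps between subsets are restrictions of total maps; [g] restricted to [G']
   is the inverse of [f] restricted to [G]. *)
Definition homeomorphism_on (G : set X) (G' : set Y) (f : X -> Y) (g : Y -> X) :
    Prop :=
  [/\ set_bij G G' f, {in G, cancel f g},
      {within G, continuous f} & {within G', continuous g}].

Definition weakly_quasisymmetric (H : R) (G : set X) (f : X -> Y) : Prop :=
  forall x a b, G x -> G a -> G b ->
    mdist x a <= mdist x b -> mdist (f x) (f a) <= H * mdist (f x) (f b).

End Maps.

(* Main.v *)
Require Import Defs.
From mathcomp Require Import all_boot all_order all_algebra.
From mathcomp Require Import all_classical all_reals all_analysis.
From mathcomp Require Import ring lra zify.

(* Chaining along short arcs shows that [f] on [D] and its inverse have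
   distortion controlled at every scale, so [f] is quasisymmetric on [D].
   Completeness of [X] then keeps the images of points deep inside [D] away from
   the boundary of [f(D)]: [bdist (f D) (f z)] dominates [|f z - f w|] as soon as
   [|z - w|] is at most a multiple of [bdist D z].

   The image of a rectifiable arc need not be rectifiable. Instead, subdivide a
   uniform arc from [x] to [y] by steps equal to a small multiple of the distance
   to the boundary of [D]. Away from [x] (resp. towards [y]) the arc length to the
   endpoint then changes geometrically, and so do the distances from the image
   points to [f x] (resp. [f y]); their sums are bounded by a single term.
   Consecutive image points are so close compared with their distance to the
   boundary of [f(D)] that they are joined in [f(D)] by the arcs given by
   quasiconvexity of [Y]. Cutting each arc of this chain at its first hit of the
   next one yields an injective path. *)

Set Implicit Arguments.
Unset Strict Implicit.
Unset Printing Implicit Defensive.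

Import Order.TTheory GRing.Theory Num.Theory.
Import numFieldNormedType.Exports.

Local Open Scope classical_set_scope.
Local Open Scope ring_scope.

(** * Length of paths *)

Section PathLength.
Context {R : realType} {X : metricType R}.
Implicit Types (a b c : R) (gam : R -> X) (s : seq R).

Lemma path_variation_nil a b gam : path_variation a b gam [::] = 0.
Proof. by rewrite /path_variation big_geq. Qed.

Lemma path_variation_cons a b gam x s :
  path_variation a b gam (x :: s) =
  mdist (gam a) (gam x) + path_variation x b gam s.
Proof. by rewrite /path_variation /= big_nat_recl. Qed.

Lemma path_variation_le_length a b gam s : itv_partition a b s ->
  ((path_variation a b gam s)%:E <= path_length a b gam)%E.
Proof. by move=> abs; apply: ereal_sup_ubound; exists s. Qed.

Lemma path_length_le a b gam (l : \bar R) :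
  (forall s, itv_partition a b s -> ((path_variation a b gam s)%:E <= l)%E) ->
  (path_length a b gam <= l)%E.
Proof. by move=> H; apply: ge_ereal_sup => _ [s abs <-]; exact: H. Qed.

Lemma path_lengthxx a gam : path_length a a gam = 0%E.
Proof.
apply/eqP; rewrite eq_le; apply/andP; split.
  apply: path_length_le => s /itv_partitionxx ->.
  by rewrite path_variation_nil.
suff : ((path_variation a a gam [::])%:E <= path_length a a gam)%E.
  by rewrite path_variation_nil.
by apply: path_variation_le_length; split.
Qed.

Lemma mdist_le_path_length a b gam : a <= b ->
  ((mdist (gam a) (gam b))%:E <= path_length a b gam)%E.
Proof.
rewrite le_eqVlt => /orP[/eqP <-|ab]; first by rewrite path_lengthxx mdistxx.
rewrite (_ : mdist _ _ = path_variation a b gam [:: b]).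
  exact/path_variation_le_length/itv_partition1.
by rewrite path_variation_cons path_variation_nil addr0.
Qed.

Lemma path_length_ge0 a b gam : a <= b -> (0 <= path_length a b gam)%E.
Proof.
by move=> ab; apply: le_trans (mdist_le_path_length gam ab); rewrite lee_fin mdist_ge0.
Qed.

Lemma path_variation_cat a b c gam s t : itv_partition a b s ->
  path_variation a c gam (s ++ t) =
  path_variation a b gam s + path_variation b c gam t.
Proof.
elim: s a => [|x s IH] a /=.
  by move=> /itv_partition_nil ->; rewrite path_variation_nil add0r.
move=> /itv_partition_cons /IH; rewrite !path_variation_cons => ->.
by rewrite addrA.
Qed.

(** Concatenating a partition of [[a, b]] with one of [[b, c]] gives a partition of [[a, c]] whose
    variation is the sum. The case of infinite length is treated apart, since the suprema are
    separated by subtracting lengths in [\bar R]. *)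
Lemma path_lengthD_le a b c gam : a <= b -> b <= c ->
  (path_length a b gam + path_length b c gam <= path_length a c gam)%E.
Proof.
move=> ab bc.
case: (path_length a b gam =P +oo%E) => [|/eqP fab].
  move=> ab_oo.
  suff -> : path_length a c gam = +oo%E by rewrite leey.
  apply/eqP; rewrite -leye_eq -ab_oo; apply: path_length_le => s abs.
  have [t bct] : exists t, itv_partition b c t.
    move: bc; rewrite le_eqVlt => /orP[/eqP <-|bc]; first by exists [::]; split.
    by exists [:: c]; exact: itv_partition1.
  apply: le_trans (path_variation_le_length gam (itv_partition_cat abs bct)).
  rewrite (path_variation_cat c gam t abs) lee_fin lerDl /path_variation.
  by apply: sumr_ge0 => i _; exact: mdist_ge0.
have abfin : path_length a b gam \is a fin_num.
  by rewrite ge0_fin_numE ?path_length_ge0// ltey.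
rewrite addeC -leeBrDr//.
apply: path_length_le => t bct; rewrite leeBrDr// addeC -leeBrDr//.
apply: path_length_le => s abs; rewrite leeBrDr// -EFinD.
apply: le_trans (path_variation_le_length gam (itv_partition_cat abs bct)).
by rewrite (path_variation_cat c gam t abs).
Qed.

Lemma path_length_le_left a b c gam : a <= b -> b <= c ->
  (path_length a b gam <= path_length a c gam)%E.
Proof.
move=> ab bc; apply: le_trans (path_lengthD_le gam ab bc).
by rewrite leeDl// path_length_ge0.
Qed.

Lemma path_length_le_right a b c gam : a <= b -> b <= c ->
  (path_length b c gam <= path_length a c gam)%E.
Proof.
move=> ab bc; apply: le_trans (path_lengthD_le gam ab bc).
by rewrite leeDr// path_length_ge0.
Qed.

(** By the triangle inequality, inserting [b] into a subdivision does not decrease the variation.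
    Partitions are strictly increasing, so [b] must not be inserted twice. *)
Lemma split_partition a b c gam s : a <= b -> b <= c -> itv_partition a c s ->
  exists s1 s2, [/\ itv_partition a b s1, itv_partition b c s2 &
    path_variation a c gam s <=
    path_variation a b gam s1 + path_variation b c gam s2].
Proof.
elim: s a => [|x s IH] a ab bc acs.
  have ac := itv_partition_nil acs.
  have eab : a = b by apply/eqP; rewrite eq_le ab ac bc.
  exists [::], [::]; rewrite !path_variation_nil addr0; split=> //.
    by rewrite eab; split.
  by rewrite -eab ac; split.
have xcs := itv_partition_cons acs.
have ax : a < x by case: acs => /= /andP[].
have [xb|bx] := leP x b.
  have [s1 [s2 [h1 h2 h3]]] := IH _ xb bc xcs.
  exists (x :: s1), s2; split => //.
    by case: h1 => h h'; split=> //=; rewrite ax.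
  by rewrite !path_variation_cons -addrA lerD2l.
have bcxs : itv_partition b c (x :: s).
  by case: acs => /= /andP[_ h] h'; split => //=; rewrite bx.
move: ab; rewrite le_eqVlt => /orP[/eqP <-|ab].
  exists [::], (x :: s); split => //.
  by rewrite path_variation_nil add0r.
exists [:: b], (x :: s); split => //; first exact: itv_partition1.
rewrite !path_variation_cons path_variation_nil addr0 addrA lerD2r.
exact: metric_triangle.
Qed.

Lemma path_length_leD a b c gam : a <= b -> b <= c ->
  (path_length a c gam <= path_length a b gam + path_length b c gam)%E.
Proof.
move=> ab bc; apply: path_length_le => s acs.
have [s1 [s2 [h1 h2 h3]]] := split_partition gam ab bc acs.
apply: (@le_trans _ _ ((path_variation a b gam s1)%:E + (path_variation b c gam s2)%:E)%E).
  by rewrite -EFinD lee_fin.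
by apply: leeD; exact: path_variation_le_length.
Qed.

Lemma eq_path_variation a b gam gam' s : itv_partition a b s ->
  (forall t, a <= t <= b -> gam t = gam' t) ->
  path_variation a b gam s = path_variation a b gam' s.
Proof.
move=> abs e; rewrite /path_variation; apply: eq_big_nat => i /andP[_ si] /=.
have in_ab j : (j < (size s).+1)%N -> a <= nth b (a :: s) j <= b.
  by move=> js; rewrite itv_partition_nth_ge// itv_partition_nth_le.
by rewrite (e _ (in_ab i (ltnW si))) (e _ (in_ab i.+1 si)).
Qed.

Lemma eq_path_length a b gam gam' :
  (forall t, a <= t <= b -> gam t = gam' t) ->
  path_length a b gam = path_length a b gam'.
Proof.
move=> e; apply/eqP; rewrite eq_le; apply/andP; split;
  apply: path_length_le => s abs.
  by rewrite (eq_path_variation abs e) path_variation_le_length.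
by rewrite -(eq_path_variation abs e) path_variation_le_length.
Qed.

Lemma path_length_shift_le a b c gam :
  (path_length a b (fun t => gam (t + c)%R) <= path_length (a + c)%R (b + c)%R gam)%E.
Proof.
apply: path_length_le => s [pas /eqP asb].
rewrite (_ : path_variation _ _ _ _ =
             path_variation (a + c) (b + c) gam [seq t + c | t <- s]).
  apply: path_variation_le_length; split.
    rewrite (@homo_path _ _ (fun t => t + c) <%O <%O)//.
    by move=> u v uv; rewrite ltrD2r.
  by rewrite (last_map (fun t => t + c)) asb.
elim: s a {pas asb} => [|x s IH] a /=; first by rewrite !path_variation_nil.
by rewrite !path_variation_cons IH.
Qed.

End PathLength.

(** * Arcs *)

Section Continuity.
Context {R : realType}.

Lemma within_continuous_ballP (T : pseudoMetricType R) (Y : metricType R)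
    (A : set T) (f : T -> Y) :
  {within A, continuous f} <->
  forall x, A x -> forall e, 0 < e ->
    exists2 d, 0 < d & forall y, A y -> ball x d y -> mdist (f x) (f y) < e.
Proof.
rewrite subspace_continuousP; split => H x Ax.
  move=> e e0; have /metricType_numDomainType.cvgrPdist_lt /(_ _ e0) := H x Ax.
  rewrite /within /= near_withinE => /nbhs_ballP [d /= d0 xd].
  by exists d => // y Ay /xd; exact.
apply/metricType_numDomainType.cvgrPdist_lt => e e0; have [d d0 xd] := H x Ax e e0.
rewrite near_withinE; apply/nbhs_ballP; exists d => // y xy Ay.
exact: xd.
Qed.

Lemma within_continuous_pathP (Y : metricType R) (a b : R) (gam : R -> Y) :
  {within `[a, b], continuous gam} <->
  forall t, a <= t <= b -> forall e, 0 < e ->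
    exists2 d, 0 < d & forall u, a <= u <= b -> `|t - u| < d ->
      mdist (gam t) (gam u) < e.
Proof.
rewrite within_continuous_ballP; split => H t abt e e0.
  have [|d d0 td] := H t _ e e0; first by rewrite /= in_itv.
  exists d => // u abu tu; apply: td => //; by rewrite /= in_itv.
have [|d d0 td] := H t _ e e0; first by move: abt; rewrite /= in_itv.
by exists d => // u; rewrite /= in_itv/= => abu tu; exact: td.
Qed.

Lemma mdist_ivt (Y : metricType R) (a b r : R) (gam : R -> Y) (p : Y) :
  a <= b -> {within `[a, b], continuous gam} ->
  mdist p (gam a) <= r -> r <= mdist p (gam b) ->
  exists2 u, a <= u <= b & mdist p (gam u) = r.
Proof.
move=> ab cg ar rb.
have cd : {within `[a, b], continuous (fun u => mdist p (gam u) : R)}.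
  apply/subspace_continuousP => t; rewrite /= in_itv/= => abt.
  apply/cvgrPdist_lt => e e0.
  have /within_continuous_pathP /(_ t abt e e0) [d d0 td] := cg.
  rewrite near_withinE; apply/nbhs_ballP; exists d => // u tu.
  rewrite /= in_itv/= => abu.
  have {}td := td u abu tu.
  have := metric_triangle p (gam t) (gam u).
  have := metric_triangle p (gam u) (gam t).
  rewrite (metric_sym (gam u) (gam t)) /from_subspace/= ltr_distl => h1 h2; apply/andP; split; lra.
have [] := @IVT _ (fun u => mdist p (gam u) : R) a b r ab cd.
  by rewrite ge_min le_max ar rb orbT.
by move=> u; rewrite in_itv/= => abu ur; exists u.
Qed.

End Continuity.

(** * Concatenating arcs into an injective path *)

Section Gluing.
Context {R : realType} {Y : metricType R}.
Implicit Types (a b c : R) (gam : R -> Y) (A : set Y) (x y : Y).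

Lemma arc_image_closed A x y a b gam : arc_joining A x y a b gam ->
  closed (gam @` `[a, b]).
Proof.
move=> [ab cg _ _ _]; apply: compact_closed; first exact: metric_hausdorff.
by apply: continuous_compact => //; exact: segment_compact.
Qed.

(** The infimum of the hitting times works: if [gam] were outside [K] there, continuity would keep
    it outside [K] nearby, while hitting times accumulate at their infimum. *)
Lemma first_hit a b gam (K : set Y) : a <= b ->
  {within `[a, b], continuous gam} -> closed K -> K (gam b) ->
  exists t, [/\ a <= t, t <= b, K (gam t) &
    forall u, a <= u -> u < t -> ~ K (gam u)].
Proof.
move=> ab /within_continuous_pathP cg cK Kb.
pose T := [set u | a <= u <= b /\ K (gam u)].
have Tb : T b by split => //; rewrite ab lexx.
have lbT : lbound T a by move=> u [/andP[]].
have hT : has_inf T by split; [exists b | exists a].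
have at_ : a <= inf T by apply: lb_le_inf => //; exists b.
have tb : inf T <= b by apply: ge_inf => //; exists a.
exists (inf T); split => //; last first.
  move=> u au ut Ku; move: (ut); rewrite ltNge => /negP; apply.
  by apply: ge_inf; [exists a|split => //; rewrite au/=; lra].
apply: contrapT => nK.
have /open_nbhs_nbhs : open_nbhs (gam (inf T)) (~` K).
  by split => //; exact: closed_openC.
move=> /nbhs_ballP[e /= e0]; rewrite ballEmdist => eK.
have [|d d0 td] := cg (inf T) _ e e0; first by rewrite at_ tb.
have [u [abu Ku] ut] := inf_adherent d0 hT.
have tu : inf T <= u by apply: ge_inf; [exists a|split].
apply: (eK (gam u)) => //=; apply: td => //.
by rewrite distrC ger0_norm; lra.
Qed.

(** Follow [gam] up to its first point on the second arc, then follow the second arc. What precedes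
    [t] is unchanged and what follows is a piece of [gam']; recording both lets lengths be tracked
    through repeated gluing. *)
Lemma glue_arcs A x y z a b gam a' b' gam' :
  arc_joining A x y a b gam -> arc_joining A y z a' b' gam' ->
  exists t e gam'', [/\ a <= t <= b, t <= e, arc_joining A x z a e gam'',
    {in `[a, t], gam'' =1 gam} &
    (forall u, t <= u <= e -> exists v, a' <= v <= b' /\ gam'' u = gam' v) /\
    (path_length t e gam'' <= path_length a' b' gam')%E].
Proof.
move=> arc arc'.
have cK := arc_image_closed arc'.
case: (arc) => ab cg ig Ag [ga gb]; case: (arc') => ab' cg' ig' Ag' [ga' gb'].
have [|t [at_ tb Kt first_t]] := first_hit ab cg cK _.
  by rewrite gb -ga'; exists a' => //; rewrite /= in_itv/= lexx ab'.
have [v] := Kt; rewrite /= in_itv/= => /andP[av vb] vt.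
(* The second arc is entered at its parameter [v]; the shift by [c] moves this parameter to [t]. *)
pose c := v - t; pose e := b' - c.
pose h u := if u <= t then gam u else gam' (u + c).
have te : t <= e by rewrite /e /c; lra.
have hl u : u <= t -> h u = gam u by rewrite /h => ->.
have hr u : t <= u -> h u = gam' (u + c).
  rewrite le_eqVlt /h => /orP[/eqP <-|tu]; last by rewrite leNgt tu.
  by rewrite lexx -vt; congr gam'; rewrite /c; lra.
have rng u : t <= u <= e -> a' <= u + c <= b'.
  by rewrite /e /c => /andP[? ?]; apply/andP; split; lra.
exists t, e, h; split => //.
- by rewrite at_ tb.
- split; first by lra.
  + have cgP := (within_continuous_pathP a b gam).1 cg.
    have cgP' := (within_continuous_pathP a' b' gam').1 cg'.
    apply/within_continuous_pathP => u /andP[au ue] r r0.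
    have [d1 d10 hd1] : exists2 d, 0 < d & forall w, a <= w <= t -> `|u - w| < d ->
        mdist (h u) (h w) < r.
      have [ut|tu] := leP u t.
        have [|d d0 hd] := cgP u _ r r0; first by lra.
        exists d => // w awt uw; rewrite !hl//; last by lra.
        by apply: hd => //; lra.
      exists (u - t); first lra.
      by move=> w awt; rewrite ltr_distl => ?; lra.
    have [d2 d20 hd2] : exists2 d, 0 < d & forall w, t <= w <= e -> `|u - w| < d ->
        mdist (h u) (h w) < r.
      have [tu|ut] := leP t u.
        have [|d d0 hd] := cgP' (u + c) _ r r0; first by apply: rng; lra.
        exists d => // w twe uw; rewrite !hr//; last by lra.
        apply: hd => //; first exact: rng.
        by rewrite (_ : u + c - (w + c) = u - w)//; ring.
      exists (t - u); first lra.
      by move=> w awt; rewrite ltr_distl => ?; lra.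
    exists (Order.min d1 d2); first by rewrite lt_min d10.
    move=> w awe; rewrite lt_min => /andP[u1 u2].
    by have [wt|tw] := leP w t; [apply: hd1|apply: hd2] => //; lra.
  (* A coincidence puts [gam u] on the second arc, so [u = t] as [t] is the first hit; injectivity
     of [gam'] then gives [w = t], against [t < w]. *)
  + have disj u w : a <= u <= e -> a <= w <= e -> u <= t -> t < w -> h u = h w -> u = w.
      move=> aue awe ut tw; rewrite hl// hr//; last lra.
      move=> huw; have wr := rng w ltac:(lra).
      have Ku : (gam' @` `[a', b']) (gam u).
        by exists (w + c) => //; rewrite /= in_itv/=.
      have [ut'|] := ltP u t; first by have := first_t u ltac:(lra) ut' Ku.
      move=> tu; have eut : u = t by lra.
      move: huw; rewrite eut -vt => /ig'; rewrite !in_itv/= av vb => /(_ isT wr).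
      by rewrite /c; lra.
    move=> u w; rewrite !in_itv/= => aue awe.
    have [ut|tu] := leP u t; have [wt|tw] := leP w t.
    * by rewrite !hl// => /ig; apply; rewrite in_itv/=; lra.
    * exact: disj.
    * by move=> /esym huw; symmetry; apply: disj.
    * rewrite !hr; [|lra|lra]; move=> /ig'; rewrite !in_itv/=.
      by rewrite !rng; [move=> /(_ isT isT); lra|lra|lra].
  + move=> u; rewrite in_itv/= => aue; have [ut|tu] := leP u t.
      by rewrite hl//; apply: Ag; rewrite in_itv/=; lra.
    by rewrite hr; [apply: Ag'; rewrite in_itv/= rng//; lra|lra].
  + split; first by rewrite hl.
    by rewrite hr// -gb'; congr gam'; rewrite /e; lra.
- by move=> u; rewrite in_itv/= => aut; rewrite hl//; lra.
- split; first by move=> u tue; exists (u + c); rewrite rng// hr//; lra.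
  rewrite (@eq_path_length _ _ t e h (fun u => gam' (u + c))); last first.
    by move=> u tue; rewrite hr//; lra.
  apply: le_trans (path_length_shift_le _ _ _ _) _.
  have -> : t + c = v by rewrite /c; lra.
  have -> : e + c = b' by rewrite /e; lra.
  exact: path_length_le_right.
Qed.

End Gluing.

Section Chain.
Context {R : realType} {Y : metricType R}.

Lemma sub_arc_joining (A B : set Y) x y a b gam : A `<=` B ->
  arc_joining A x y a b gam -> arc_joining B x y a b gam.
Proof. by move=> AB [ab cg ig Ag e]; split=> // t /Ag /AB. Qed.

(** Arcs are glued one at a time. Cutting may discard pieces, so each point remembers the index [j]
    of the arc it comes from: the set [S j] localizes it, and the lengths on its two sides are
    bounded by partial sums that both include [l j]. *)
Lemma arc_chain (A : set Y) (S : nat -> set Y) (p : nat -> Y) (l : nat -> R)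
    (N : nat) :
  (forall j, (j <= N)%N -> S j `<=` A) ->
  (forall j, (j <= N)%N -> exists a b gam,
    arc_joining (S j) (p j) (p j.+1) a b gam /\
    (path_length a b gam <= (l j)%:E)%E) ->
  exists a b gam, arc_joining A (p 0%N) (p N.+1) a b gam /\
    forall u, a <= u <= b -> exists j : nat,
      [/\ (j <= N)%N, S j (gam u),
        (path_length a u gam <= (\sum_(0%N <= i < j.+1) l i)%:E)%E &
        (path_length u b gam <= (\sum_(j <= i < N.+1) l i)%:E)%E].
Proof.
elim: N => [|N IH] SA arcs.
  have [a [b [gam [arc len]]]] := arcs 0%N (leqnn _).
  exists a, b, gam; split; first exact: (sub_arc_joining (SA _ (leqnn _)) arc).
  move=> u /andP[au ub]; exists 0%N; rewrite !big_nat1; split => //.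
  - by case: arc => _ _ _ + _; apply; rewrite in_itv/= au.
  - exact: le_trans (path_length_le_left _ au ub) len.
  - exact: le_trans (path_length_le_right _ au ub) len.
have [|j jN|a [b [gam [arc pt]]]] := IH.
- by move=> j jN; apply: SA; rewrite leqW.
- by apply: arcs; rewrite leqW.
have [a' [b' [gam' [arc' len']]]] := arcs N.+1 (leqnn _).
have arcA' := sub_arc_joining (SA N.+1 (leqnn _)) arc'.
have [t [e [h [/andP[at_ tb] te arch hl [hr lenh]]]]] := glue_arcs arc arcA'.
exists a, e, h; split=> // u /andP[au ue].
have hlE v w : a <= v -> w <= t -> path_length v w h = path_length v w gam.
  move=> av wt; apply: eq_path_length => x vxw.
  by apply: hl; rewrite in_itv/=; lra.
have [ut|tu] := leP u t.
  have [|j [jN Sj lenl lenr]] := pt u; first by lra.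
  exists j; split.
  - by rewrite leqW.
  - by rewrite hl// in_itv/= au.
  - by rewrite hlE.
  - rewrite big_nat_recr/=; last by rewrite leqW.
    apply: le_trans (path_length_leD h ut te) _; rewrite EFinD; apply: leeD.
      rewrite hlE//; apply: le_trans lenr; exact: path_length_le_left.
    exact: le_trans lenh len'.
exists N.+1; split => //.
- have [|v [vab ->]] := hr u; first by lra.
  by case: arc' => _ _ _ + _; apply; rewrite in_itv.
- apply: le_trans (path_length_leD h at_ (ltW tu)) _.
  rewrite big_nat_recr//= EFinD; apply: leeD.
    (* The cut point [t] may lie on any earlier arc; its partial sum is at most the full one because
       each [l i] bounds a length. *)
    rewrite hlE//; have [|j [jN _ lenl lenr]] := pt t; first by lra.
    apply: le_trans lenl _; rewrite lee_fin.
    rewrite [leRHS](big_cat_nat (leq0n j.+1))//= lerDl.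
    rewrite big_nat_cond; apply: sumr_ge0 => i /andP[/andP[_ iN] _].
    have [|a0 [b0 [g0 [[ab0 _ _ _ _] len0]]]] := arcs i; first by rewrite ltnW.
    by rewrite -lee_fin; apply: le_trans len0; exact: path_length_ge0.
  apply: le_trans (le_trans lenh len').
  by apply: path_length_le_left => //; exact: ltW.
- rewrite big_nat1; apply: le_trans (le_trans lenh len').
  by apply: path_length_le_right => //; exact: ltW.
Qed.

End Chain.

(** * Distance to the boundary *)

Section BoundaryDistance.
Context {R : realType} {X : metricType R}.
Implicit Types (D : set X) (x y z w : X).

Lemma bdist_le D z w : boundary D w -> bdist D z <= mdist z w.
Proof.
move=> Dw; apply: ge_inf; last by exists w.
by exists 0 => _ [v _ <-]; exact: mdist_ge0.
Qed.

(** The boundary has to be nonempty: the infimum of the empty set is 0 by convention. *)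
Lemma bdist_ge D z (r : R) : boundary D !=set0 ->
  (forall w, boundary D w -> r <= mdist z w) -> r <= bdist D z.
Proof.
move=> [w Dw] H; apply: lb_le_inf; first by exists (mdist z w), w.
by move=> _ [v Dv <-]; exact: H.
Qed.

Lemma bdist_ge0 D z : boundary D !=set0 -> 0 <= bdist D z.
Proof. by move=> D0; apply: bdist_ge => // w _; exact: mdist_ge0. Qed.

Lemma bdist_lipschitz D z w : boundary D !=set0 ->
  bdist D z <= mdist z w + bdist D w.
Proof.
move=> D0; rewrite -lerBlDl; apply: bdist_ge => // v Dv.
rewrite lerBlDl; apply: le_trans (metric_triangle z w v); exact: bdist_le.
Qed.

Lemma open_boundaryP D w : open D -> boundary D w <-> closure D w /\ ~ D w.
Proof. by move=> /interior_id oD; rewrite /boundary oD. Qed.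

Lemma bdist_gt0 D z : open D -> D z -> boundary D !=set0 -> 0 < bdist D z.
Proof.
move=> oD Dz D0; have /nbhs_ballP[e /= e0] := open_nbhs_nbhs (conj oD Dz).
rewrite ballEmdist => eD; apply: lt_le_trans e0 _; apply: bdist_ge => // w.
move=> /(open_boundaryP _ oD)[_ nDw]; rewrite leNgt; apply/negP => zw.
exact/nDw/eD.
Qed.

(** A short arc from [z] to [w] meets the complement of [D] for the first time at a boundary point,
    being there a limit of points of [D]. *)
Lemma exit_boundary c D z w : quasiconvex c [set: X] -> open D ->
  D z -> ~ D w -> exists2 p, boundary D p & mdist z p <= c * mdist z w.
Proof.
move=> [_ qc] oD Dz nDw; have [a [b [gam [arc len]]]] := qc z w I I.
case: (arc) => ab cg ig _ [ga gb].
have [||t [at_ tb nDt tD]] := @first_hit _ _ _ _ _ (~` D) ab cg.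
- exact: open_closedC.
- by rewrite /setC/= gb.
have a_lt_t : a < t.
  by rewrite lt_neqAle at_ andbT; apply/eqP => E; apply: nDt; rewrite -E ga.
exists (gam t); last first.
  rewrite -lee_fin; apply: le_trans len; rewrite -ga.
  by apply: le_trans (mdist_le_path_length gam at_) (path_length_le_left _ at_ tb).
apply/(open_boundaryP _ oD); split => // B /nbhs_ballP[e /= e0].
rewrite ballEmdist => eB.
have [|d d0 td] := (within_continuous_pathP a b gam).1 cg t _ e e0.
  by rewrite at_ tb.
(* A time just before the exit time [t]; the maximum keeps it in the interval, and [a < t] keeps it
   before [t]. *)
pose u := Order.max a (t - d / 2).
have au : a <= u by rewrite /u le_max lexx.
have ut : u < t by rewrite /u gt_max a_lt_t/=; lra.
exists (gam u); split; first by apply: contrapT; exact: tD.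
apply/eB/td; first by lra.
have : t - d / 2 <= u by rewrite /u le_max lexx orbT.
by move=> tu; rewrite ger0_norm; lra.
Qed.

Lemma boundary_neq0 c D : quasiconvex c [set: X] -> open D -> D !=set0 ->
  D `<` [set: X] -> boundary D !=set0.
Proof.
move=> qc oD [z Dz] [_ /existsNP[w /not_implyP[_ nDw]]].
by have [p Dp _] := exit_boundary qc oD Dz nDw; exists p.
Qed.

Lemma bdist_le_outside c D z w : quasiconvex c [set: X] -> open D ->
  D z -> ~ D w -> bdist D z <= c * mdist z w.
Proof.
move=> qc oD Dz nDw; have [p Dp] := exit_boundary qc oD Dz nDw.
by apply: le_trans; exact: bdist_le.
Qed.

End BoundaryDistance.

(** * Distortion bounds from weak quasisymmetry *)

Section Growth.
Context {R : realType}.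

(* Quasisymmetry with gauge [eta] is [distortion_le t (eta t)] for all [t];
   weak [H]-quasisymmetry is the case [t = 1], [C = H]. *)
Definition distortion_le (X Y : metricType R) (t C : R) (A : set X)
    (f : X -> Y) : Prop :=
  forall x a b, A x -> A a -> A b ->
    mdist x a <= t * mdist x b -> mdist (f x) (f a) <= C * mdist (f x) (f b).

Lemma weakly_quasisymmetric_ge1 (X Y : metricType R) H (A : set X) (f : X -> Y) :
  weakly_quasisymmetric H A f -> weakly_quasisymmetric (Order.max H 1) A f.
Proof.
move=> wqs x a b Ax Aa Ab ab; apply: le_trans (wqs x a b Ax Aa Ab ab) _.
by apply: ler_wpM2r; rewrite ?mdist_ge0// le_max lexx.
Qed.

(** Walk from [x] to [a] along a short arc in hops of size [|x - b|]. About [c * t] hops suffice, so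
    the constant is fixed before the spaces and the map. *)
Lemma weakly_quasisymmetric_distortion_le (H c t : R) : exists2 C, 0 < C &
  forall (X Y : metricType R) (A : set X) (f : X -> Y),
    quasiconvex c A -> weakly_quasisymmetric H A f -> distortion_le t C A f.
Proof.
pose K := Order.max H 1; have K1 : 1 <= K by rewrite le_max lexx orbT.
(* One more hop turns a bound [C] into [K * (1 + C)]: the hop costs a factor [K], the rest of the
   walk at most [C] times the hop. *)
pose C (n : nat) : R := iter n (fun C : R => K * (1 + C)) K.
have CK n : K <= C n.
  elim: n => [|n IH] //=; rewrite ler_peMr; lra.
pose n := Num.bound (Order.max (c * t) 0).
have ctn : c * t <= n%:R.
  apply: (@le_trans _ _ (Order.max (c * t) 0)); first by rewrite le_max lexx.
  have m0 : 0 <= Order.max (c * t) 0 by rewrite le_max lexx orbT.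
  exact/ltW/archi_boundP.
exists (C n); first by have := CK n; lra.
move=> X Y A f [c1 qc] /weakly_quasisymmetric_ge1 wqs x a b Ax Aa Ab xab.
have [u0 [v [gam [arc len]]]] := qc x a Ax Aa.
case: (arc) => uv cg ig Ag [gu gv].
have r0 : 0 <= mdist x b := mdist_ge0 _ _.
(* Generalizes over the current point [gam u] and a reference point [p] at distance at least one
   hop; [m] hops cover the remaining length. *)
suff main m u p : u0 <= u <= v -> A p -> mdist x b <= mdist (gam u) p ->
    (path_length u v gam <= (m%:R * mdist x b)%:E)%E ->
    mdist (f (gam u)) (f a) <= C m * mdist (f (gam u)) (f p).
  rewrite -{1 2}gu; apply: main => //; first by rewrite lexx.
    by rewrite gu.
  apply: le_trans len _; rewrite lee_fin.
  apply: (@le_trans _ _ (c * (t * mdist x b))).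
    by apply: ler_wpM2l => //; lra.
  by rewrite mulrA; apply: ler_wpM2r.
elim: m u p => [|m IH] u p /andP[u0u uv'] Ap rp len_u.
  have : ((mdist (gam u) (gam v))%:E <= 0%:E :> \bar R)%E.
    apply: le_trans (mdist_le_path_length gam uv') _.
    by rewrite mul0r in len_u.
  rewrite lee_fin gv => ua0.
  have /mdist_positivity -> : mdist (gam u) a = 0.
    by apply/eqP; rewrite eq_le ua0 mdist_ge0.
  by rewrite mdistxx mulr_ge0 ?mdist_ge0//; have := CK 0%N; lra.
have Au w : u0 <= w <= v -> A (gam w) by move=> ?; apply: Ag; rewrite in_itv.
have [ur|ru] := leP (mdist (gam u) a) (mdist x b).
  have fup : mdist (f (gam u)) (f a) <= K * mdist (f (gam u)) (f p).
    by apply: wqs => //; [apply: Au; lra|exact: le_trans rp].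
  apply: le_trans fup _; apply: ler_wpM2r; first exact: mdist_ge0.
  exact: CK.
(* The next stop [gam w] is exactly one hop away, so the remaining length drops by at least
   [|x - b|]; from there [gam u] serves as reference point. *)
have [|||w uwv uw] := @mdist_ivt _ X u v (mdist x b) gam (gam u) uv'.
- by apply: continuous_subspaceW cg => z; rewrite /= !in_itv/=; lra.
- by rewrite mdistxx.
- by rewrite gv ltW.
have wa : mdist (f (gam w)) (f a) <= C m * mdist (f (gam w)) (f (gam u)).
  apply: IH; first by lra.
  - by apply: Au; lra.
  - by rewrite (metric_sym (gam w)) uw.
  - have uw_le : u <= w by lra.
    have wv_le : w <= v by lra.
    have := le_trans (path_lengthD_le gam uw_le wv_le) len_u.
    rewrite -natr1 mulrDl mul1r => h.
    have {h} := le_trans (leeD2r _ (mdist_le_path_length gam uw_le)) h.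
    by rewrite uw EFinD (addeC (mdist x b)%:E) leeD2rE.
have uwp : mdist (f (gam u)) (f (gam w)) <= K * mdist (f (gam u)) (f p).
  by apply: wqs => //; [apply: Au; lra|apply: Au; lra|rewrite uw].
apply: le_trans (metric_triangle _ (f (gam w)) _) _.
rewrite [C m.+1]/= -/(C m) in wa *.
rewrite (metric_sym (f (gam w)) (f (gam u))) in wa.
apply: le_trans (lerD (lexx _) wa) _.
have Cm : 0 <= 1 + C m by have := CK m; lra.
rewrite (_ : K * (1 + C m) * _ = (1 + C m) * (K * mdist (f (gam u)) (f p))); last by ring.
apply: le_trans (ler_wpM2l Cm uwp); lra.
Qed.

(** By contraposition: if the conclusion fails, the bound on [g] gives [|x - b| <= C * |x - a|],
    against [(C + 1) * |x - a| <= |x - b|]. A large [t] makes the distortion of [f] small at a small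
    scale. *)
Lemma inverse_distortion_le (X Y : metricType R) (t C : R) (A : set X)
    (A' : set Y) (f : X -> Y) (g : Y -> X) :
  0 < t -> 0 <= C -> (forall x, A x -> A' (f x)) -> {in A, cancel f g} ->
  distortion_le t C A' g -> distortion_le (C + 1)^-1 t^-1 A f.
Proof.
move=> t0 C0 fA fK dg x a b Ax Aa Ab xab.
have C10 : 0 < C + 1 by lra.
have [<-|/eqP xa] := eqVneq x a.
  by rewrite mdistxx mulr_ge0 ?mdist_ge0 ?invr_ge0 ?ltW.
rewrite mulrC ler_pdivlMr// mulrC leNgt; apply/negP => lt_ba.
have := dg (f x) (f b) (f a) (fA _ Ax) (fA _ Ab) (fA _ Aa) (ltW lt_ba).
rewrite !fK ?inE// => xbC.
have xa0 : 0 < mdist x a by rewrite mdist_gt0; apply/eqP.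
move: xab; rewrite mulrC ler_pdivlMr//; lra.
Qed.

End Growth.

(** * Boundary of the image *)

Section ImageBoundary.
Context {R : realType} {X : completeMetricType R} {Y : metricType R}.

(** Otherwise the preimages of points near [v] stay well inside [D]. Small distortion of [g] makes
    them Cauchy, completeness yields a limit [p] in [D], and continuity gives [f p = v], although
    [v] is not in the image. *)
Lemma image_near_boundary_unbounded (c r : R) (D : set X) (f : X -> Y)
    (g : Y -> X) (z : X) (v : Y) :
  quasiconvex c [set: X] -> open D -> boundary D !=set0 ->
  {within D, continuous f} -> {in D, cancel f g} ->
  (forall e, 0 < e -> exists2 t, 0 < t & distortion_le t e (f @` D) g) ->
  D z -> closure (f @` D) v -> ~ (f @` D) v -> 0 < r ->
  exists w, [/\ D w, mdist v (f w) < r & bdist D z <= 2 * c * mdist z w].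
Proof.
move=> qc oD bD cf fK dec Dz clv nv r0.
apply: contrapT => /forallNP far.
have c1 : 1 <= c by case: qc.
have d0 : 0 < bdist D z := bdist_gt0 oD Dz bD.
set d := bdist D z in d0 far *.
have near_z w : D w -> mdist v (f w) < r -> 2 * c * mdist z w < d.
  by move=> Dw vw; rewrite ltNge; apply/negP => dw; apply: (far w); split.
have PF : ProperFilter (within (f @` D) (nbhs v)) by exact: within_nbhs_proper.
pose F := g @ within (f @` D) (nbhs v).
have Fv (P : X -> Prop) s : 0 < s ->
    (forall w, D w -> mdist v (f w) < s -> P w) -> F P.
  move=> s0 HP; apply/nbhs_ballP; exists s => // v' + [w Dw wv'].
  by rewrite -wv' ballEmdist /= fK ?inE// => vw; exact: HP.
have v_z : 0 < mdist v (f z).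
  rewrite mdist_gt0; apply/eqP => E; apply: nv; rewrite E; exact: imageP.
have FC : cauchy_ex F.
  move=> e e0.
  have [|t t0 dg] := dec (e / d); first by rewrite divr_gt0.
  (* Within [s] of [v], image points are at least [mdist v (f z) / 2] from [f z] and at most [t]
     times that from one another, so [dg] applies with reference point [f z]. *)
  pose s := Order.min r (Order.min (mdist v (f z) / 2) (t * mdist v (f z) / 4)).
  have s0 : 0 < s by rewrite !lt_min r0 divr_gt0//= divr_gt0// mulr_gt0.
  have [sr sv st] : [/\ s <= r, s <= mdist v (f z) / 2 & s <= t * mdist v (f z) / 4].
    by split; rewrite /s !ge_min lexx ?orbT.
  have [_ [[w Dw <-]]] := clv _ (nbhsx_ballx v s s0).
  rewrite ballEmdist /= => vw; exists w.
  apply: (Fv _ s s0) => w' Dw' vw'; rewrite ballEmdist /=.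
  have ww' : mdist (f w) (f w') <= t * mdist (f w) (f z).
    have := metric_triangle (f w) v (f w').
    have := metric_triangle v (f w) (f z).
    rewrite (metric_sym (f w) v) => h1 h2.
    apply: (@le_trans _ _ (t * (mdist v (f z) / 2))); first lra.
    by apply: ler_wpM2l; lra.
  have := dg (f w) (f w') (f z); rewrite !fK ?inE// => /(_ _ _ _ ww') h.
  apply: le_lt_trans (h _ _ _) _; try exact: imageP.
  have zw := near_z w Dw (lt_le_trans vw sr).
  rewrite mulrAC ltr_pdivrMr// ltr_pM2l// metric_sym.
  have := mdist_ge0 z w; nra.
have /cvg_ex[p Fp] : cvg F by apply: cauchy_cvg; exact: cauchy_exP.
have close s : 0 < s -> exists w, [/\ D w, mdist v (f w) < s & mdist p w < s].
  move=> s0.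
  have F1 : F (fun w => D w /\ mdist v (f w) < s) by apply: (Fv _ s s0) => w.
  have F2 : F (fun w => mdist p w < s).
    by move/metricType_numDomainType.fcvgrPdist_lt : Fp; exact.
  have [w [[Dw vw] pw]] := filter_ex (filterI F1 F2).
  by exists w.
have zp : 2 * c * mdist z p <= d.
  apply/ler_addgt0Pr => e e0.
  pose s := Order.min r (e / (2 * c)).
  have s0 : 0 < s by rewrite lt_min r0 divr_gt0//; lra.
  have [w [Dw vw pw]] := close s s0.
  have {}vw : mdist v (f w) < r by apply: lt_le_trans vw _; rewrite ge_min lexx.
  have {}pw : mdist p w < e / (2 * c).
    by apply: lt_le_trans pw _; rewrite ge_min lexx orbT.
  move: pw; rewrite ltr_pdivlMr; last lra.
  have := near_z w Dw vw; have := metric_triangle z w p.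
  rewrite (metric_sym w p) => h1 h2 h3.
  have : 2 * c * mdist z p <= 2 * c * (mdist z w + mdist p w).
    by apply: ler_wpM2l => //; lra.
  lra.
(* A point outside [D] satisfies [d <= c * mdist z p], whereas [zp] bounds the right side by
   [d / 2]. *)
have Dp : D p.
  apply: contrapT => nDp; have := bdist_le_outside qc oD Dz nDp.
  rewrite -/d; lra.
apply: nv; exists p => //; apply/esym/mdist_positivity.
apply/eqP; rewrite eq_le mdist_ge0 andbT; apply/ler_addgt0Pr => e e0.
rewrite add0r.
have [|s s0 ps] := (within_continuous_ballP D f).1 cf p Dp (e / 2).
  by rewrite divr_gt0.
have [|w [Dw vw pw]] := close (Order.min s (e / 2)).
  by rewrite lt_min s0 divr_gt0.
have {}vw : mdist v (f w) < e / 2.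
  by apply: lt_le_trans vw _; rewrite ge_min lexx orbT.
have {}pw : mdist p w < s by apply: lt_le_trans pw _; rewrite ge_min lexx.
have := ps w Dw; rewrite ballEmdist => /(_ pw).
have := metric_triangle v (f w) (f p); rewrite (metric_sym (f w)); lra.
Qed.

(** For [v] in the boundary of the image, take [u] with [f u] near [v] and
    [bdist D z <= 2 * c * |z - u|]. Then [|z - w| <= 2 * c * t * |z - u|], and the distortion of [f]
    compares [|f z - f w|] with [|f z - f u|], hence with [|f z - v|]. *)
Lemma mdist_image_le_bdist (c t K : R) (D : set X) (f : X -> Y) (g : Y -> X) :
  quasiconvex c [set: X] -> open D -> boundary D !=set0 ->
  open (f @` D) -> boundary (f @` D) !=set0 ->
  {within D, continuous f} -> {in D, cancel f g} ->
  (forall e, 0 < e -> exists2 s, 0 < s & distortion_le s e (f @` D) g) ->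
  0 <= t -> 0 < K -> distortion_le (2 * c * t) K D f ->
  forall z w, D z -> D w -> mdist z w <= t * bdist D z ->
  mdist (f z) (f w) <= K * bdist (f @` D) (f z).
Proof.
move=> qc oD bD ofD bfD cf fK dec t0 K0 df z w Dz Dw zw.
have c1 : 1 <= c by case: qc.
rewrite -ler_pdivrMl//; apply: bdist_ge => // v /(open_boundaryP _ ofD)[clv nv].
apply/ler_addgt0Pr => e e0; rewrite ler_pdivrMl//.
have [u [Du vu zu]] := image_near_boundary_unbounded qc oD bD cf fK dec Dz clv nv e0.
apply: (@le_trans _ _ (K * mdist (f z) (f u))).
  apply: df => //; apply: le_trans zw _.
  by rewrite (mulrC (2 * c)) -mulrA ler_wpM2l.
apply: ler_wpM2l; first exact: ltW.
have := metric_triangle (f z) v (f u); lra.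
Qed.

End ImageBoundary.

(** * Geometric sums along a subdivision *)

Section GeometricSums.
Context {R : realType} {X Y : metricType R}.

Lemma quasiconvex_sphere (c r : R) (D : set X) x y : quasiconvex c D ->
  D x -> D y -> 0 <= r <= mdist x y -> exists2 w, D w & mdist x w = r.
Proof.
move=> [_ qc] Dx Dy /andP[r0 rxy].
have [a [b [gam [[ab cg _ Dg [ga gb]] _]]]] := qc x y Dx Dy.
have [||u aub xu] := @mdist_ivt _ _ a b r gam x ab cg.
- by rewrite ga mdistxx.
- by rewrite gb.
by exists (gam u) => //; apply: Dg; rewrite in_itv.
Qed.

Lemma geometric_growth (kap : R) (sig : nat -> R) k m : 0 <= kap ->
  (forall j, (j < k)%N -> (1 + kap) * sig j <= sig j.+1) -> (m <= k)%N ->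
  (1 + kap) ^+ m * sig (k - m)%N <= sig k.
Proof.
move=> kap0 grow; elim: m => [|m IH] mk; first by rewrite expr0 mul1r subn0.
apply: le_trans (IH (ltnW mk)); rewrite exprSr -mulrA.
apply: ler_wpM2l; first by apply: exprn_ge0; lra.
have -> : (k - m = (k - m.+1).+1)%N by lia.
by apply: grow; lia.
Qed.

Lemma exists_geometric_exponent (kap lam : R) : 0 < kap -> 0 < lam ->
  exists2 m : nat, (0 < m)%N & 1 <= lam * (1 + kap) ^+ m.
Proof.
move=> kap0 lam0; pose m := Num.bound (lam^-1 / kap).
have mP : lam^-1 / kap < m%:R.
  by apply: archi_boundP; rewrite ltW// divr_gt0// invr_gt0.
have bern n : 1 + n%:R * kap <= (1 + kap) ^+ n.
  elim: n => [|n IH]; first by rewrite expr0; lra.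
  rewrite exprS -natr1.
  have : 0 <= n%:R :> R by [].
  have : (1 + kap) * (1 + n%:R * kap) <= (1 + kap) * (1 + kap) ^+ n.
    by apply: ler_wpM2l => //; lra.
  nra.
exists m.+1 => //; rewrite -ler_pdivrMl// mulr1.
apply: le_trans (bern _); rewrite -natr1.
by move: mP; rewrite ltr_pdivrMr//; lra.
Qed.

(* Going back [m] indices divides [sig] by at least [B / tau], which halves the
   bound [P]: the sum is dominated by a geometric series of blocks of [m] terms. *)
Lemma sum_mdist_image_le (D : set X) (f : X -> Y) (B tau kap r : R) (m : nat)
    (x : X) :
  distortion_le tau 2^-1 D f -> 0 < tau -> 1 <= B -> 0 <= kap -> (0 < m)%N ->
  1 <= tau / B * (1 + kap) ^+ m -> D x ->
  (forall rho, 0 <= rho <= r -> exists2 w, D w & mdist x w = rho) ->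
  forall (k : nat) (sig : nat -> R) (v : nat -> X) (P : R),
  (forall j, (j <= k)%N -> D (v j) /\ mdist x (v j) <= sig j) ->
  (forall j, (j < k)%N -> (1 + kap) * sig j <= sig j.+1) ->
  sig k <= B * r ->
  (forall w, D w -> mdist x w <= sig k -> mdist (f x) (f w) <= P) ->
  \sum_(0 <= j < k.+1) mdist (f x) (f (v j)) <= 2 * m%:R * P.
Proof.
move=> df tau0 B1 kap0 m0 mP Dx reach k.
elim/ltn_ind: k => k IH sig v P vP grow sigr PP.
have sig0 j : (j <= k)%N -> 0 <= sig j.
  by move=> /vP[_]; apply: le_trans; exact: mdist_ge0.
have P0 : 0 <= P.
  by apply: le_trans (PP x Dx _); rewrite mdistxx ?sig0.
have sigk j : (j <= k)%N -> sig j <= sig k.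
  move=> jk; have := geometric_growth kap0 grow (leq_subr j k).
  rewrite subKn//; apply: le_trans; rewrite ler_peMl ?sig0//.
  by apply: exprn_ege1; lra.
have termP j : (j <= k)%N -> mdist (f x) (f (v j)) <= P.
  by move=> jk; have [Dv xv] := vP j jk; apply: PP => //; exact: le_trans (sigk j jk).
have sum_tail n : (n <= k.+1)%N ->
    \sum_(n <= j < k.+1) mdist (f x) (f (v j)) <= (k.+1 - n)%:R * P.
  move=> nk; rewrite mulr_natl -sumr_const_nat.
  by rewrite big_nat [leRHS]big_nat; apply: ler_sum => j /andP[_ jk]; exact: termP.
have [km|mk] := ltnP k m.
  apply: le_trans (sum_tail _ _) _ => //; rewrite subn0.
  apply: ler_wpM2r => //; apply: (@le_trans _ _ m%:R); first by rewrite ler_nat.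
  by have : 0 <= m%:R :> R by []; lra.
rewrite (@big_cat_nat _ _ _ (k - m).+1)//=; last by lia.
have tail := sum_tail (k - m).+1 ltac:(lia).
rewrite (_ : (k.+1 - (k - m).+1 = m)%N) in tail; last by lia.
(* The last [m] terms contribute at most [m * P]; the others contribute as much by induction with
   [P / 2]. *)
suff : \sum_(0 <= j < (k - m).+1) mdist (f x) (f (v j)) <= 2 * m%:R * (P / 2).
  by move: tail; lra.
apply: (IH (k - m)%N _ sig) => //; first lia.
- by move=> j jk; apply: vP; lia.
- by move=> j jk; apply: grow; lia.
- by apply: le_trans sigr; apply: sigk; lia.
move=> w Dw xw.
(* The reference point [w0] is far enough from [x] that [|x - w| <= tau * |x - w0|], and still
   within [sig k], so that [P] bounds its image. *)
have [|w0 Dw0 xw0] := reach (sig k / B).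
  by rewrite divr_ge0 ?sig0//=; [rewrite ler_pdivrMr; lra|lra].
have xw' : mdist x w <= tau * mdist x w0.
  rewrite xw0; apply: le_trans xw _.
  have smk : 0 <= sig (k - m)%N by apply: sig0; lia.
  apply: (@le_trans _ _ (tau / B * (1 + kap) ^+ m * sig (k - m)%N)).
    by rewrite ler_peMl.
  have -> : tau * (sig k / B) = tau / B * sig k by ring.
  rewrite -[leLHS]mulrA; apply: ler_wpM2l.
    by rewrite divr_ge0//; lra.
  exact: geometric_growth.
apply: le_trans (df x w w0 Dx Dw Dw0 xw') _.
rewrite mulrC; apply: ler_wpM2r => //; apply: PP => //.
rewrite xw0 ler_pdivrMr; last by lra.
by rewrite ler_peMr ?sig0.
Qed.

(** Each step is compared with a detour through [f x], which counts every distance to [f x] at most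
    twice. *)
Lemma sum_mdist_step_le (D : set X) (f : X -> Y) (B tau kap r : R) (m : nat)
    (x : X) :
  distortion_le tau 2^-1 D f -> 0 < tau -> 1 <= B -> 0 <= kap -> (0 < m)%N ->
  1 <= tau / B * (1 + kap) ^+ m -> D x ->
  (forall rho, 0 <= rho <= r -> exists2 w, D w & mdist x w = rho) ->
  forall (k : nat) (sig : nat -> R) (v : nat -> X) (P : R),
  (forall j, (j <= k)%N -> D (v j) /\ mdist x (v j) <= sig j) ->
  (forall j, (j < k)%N -> (1 + kap) * sig j <= sig j.+1) ->
  sig k <= B * r ->
  (forall w, D w -> mdist x w <= sig k -> mdist (f x) (f w) <= P) ->
  \sum_(0 <= j < k) mdist (f (v j)) (f (v j.+1)) <= 4 * m%:R * P.
Proof.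
move=> df tau0 B1 kap0 m0 mP Dx reach k sig v P vP grow sigr PP.
have := sum_mdist_image_le df tau0 B1 kap0 m0 mP Dx reach vP grow sigr PP.
set S := \sum_(0 <= j < k.+1) _ => SP.
apply: (@le_trans _ _ (S + S)); last by lra.
apply: (@le_trans _ _ (\sum_(0 <= j < k)
    (mdist (f x) (f (v j)) + mdist (f x) (f (v j.+1))))).
  apply: ler_sum => j _; rewrite (metric_sym (f x) (f (v j))).
  exact: metric_triangle.
rewrite big_split/=; apply: lerD.
  by rewrite /S big_nat_recr//= lerDl mdist_ge0.
by rewrite /S big_nat_recl//= lerDr mdist_ge0.
Qed.

(** From each point, move on to a point at distance exactly [step]. The potential [T], later the
    remaining length, drops by at least [d] each time, so the process stops; only the last step may
    be shorter. *)
Lemma greedy_subdivision (a b d : R) (gam : R -> X) (step T : R -> R) :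
  a <= b -> {within `[a, b], continuous gam} -> 0 < d ->
  (forall u, a <= u <= b -> d <= step u) ->
  (forall u v, a <= u -> u <= v -> v <= b ->
    T v + mdist (gam u) (gam v) <= T u) ->
  0 <= T b ->
  exists (N : nat) (t : nat -> R), [/\ t 0%N = a, t N.+1 = b,
    forall j, (j <= N)%N -> [/\ a <= t j, t j <= t j.+1, t j.+1 <= b &
      mdist (gam (t j)) (gam (t j.+1)) <= step (t j)] &
    forall j, (j < N)%N -> mdist (gam (t j)) (gam (t j.+1)) = step (t j)].
Proof.
move=> ab cg d0 stepd TP Tb.
pose subdivided u := exists (N : nat) (t : nat -> R), [/\ t 0%N = u, t N.+1 = b,
    forall j, (j <= N)%N -> [/\ a <= t j, t j <= t j.+1, t j.+1 <= b &
      mdist (gam (t j)) (gam (t j.+1)) <= step (t j)] &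
    forall j, (j < N)%N -> mdist (gam (t j)) (gam (t j.+1)) = step (t j)].
suff main (n : nat) u : a <= u <= b -> T u <= n%:R * d -> subdivided u.
  apply: (main (Num.bound (T a / d))); first by rewrite lexx.
  rewrite -ler_pdivrMr//; apply/ltW/archi_boundP/divr_ge0; last exact: ltW.
  have := TP a b (lexx _) ab (lexx _); have := mdist_ge0 (gam a) (gam b); lra.
move: n u; have one_step u : a <= u <= b -> mdist (gam u) (gam b) <= step u -> subdivided u.
  move=> /andP[au ub] ustep.
  exists 0%N, (fun j => if j is 0%N then u else b); split => // j.
  by rewrite leqn0 => /eqP ->; split.
elim=> [|n IH] u aub Tu; have [ub|ub] := leP (mdist (gam u) (gam b)) (step u).
- exact: one_step.
- have /andP[au ub'] := aub.
  by have := TP u b au ub' (lexx _); have := stepd u aub; lra.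
- exact: one_step.
have /andP[au ub'] := aub.
have [|||w uwb uw] := @mdist_ivt _ _ u b (step u) gam (gam u) ub'.
- by apply: continuous_subspaceW cg => z; rewrite /= !in_itv/=; lra.
- by rewrite mdistxx; have := stepd u aub; lra.
- exact: ltW.
have /andP[uw' wb] := uwb.
have [||N [t [t0 tN tP tE]]] := IH w; first by lra.
  have := TP u w au uw' wb; have := stepd u aub; rewrite uw.
  by move: Tu; rewrite -natr1; lra.
exists N.+1, (fun j => if j is j'.+1 then t j' else u); split => //.
  case=> [|j] jN; last exact: tP.
  by rewrite t0; split => //; rewrite uw.
by case=> [|j] jN; [rewrite t0|exact: tE].
Qed.

End GeometricSums.

(** * Uniformity of the image *)

Lemma finite_length_functions (R : realType) (X : metricType R) (a c L : R)
    (gam : R -> X) :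
  a <= c -> (path_length a c gam <= L%:E)%E ->
  exists s T : R -> R, [/\ s a = 0, T c = 0,
    forall u, a <= u <= c ->
      [/\ path_length a u gam = (s u)%:E, path_length u c gam = (T u)%:E,
          0 <= s u <= L & 0 <= T u <= L],
    forall u v, a <= u -> u <= v -> v <= c ->
      s u + mdist (gam u) (gam v) <= s v &
    forall u v, a <= u -> u <= v -> v <= c ->
      T v + mdist (gam u) (gam v) <= T u].
Proof.
move=> ac len.
pose s u := fine (path_length a u gam); pose T u := fine (path_length u c gam).
have sE u : a <= u <= c -> path_length a u gam = (s u)%:E.
  move=> /andP[au uc]; rewrite /s fineK// ge0_fin_numE ?path_length_ge0//.
  apply: le_lt_trans (ltry L); apply: le_trans len; exact: path_length_le_left.
have TE u : a <= u <= c -> path_length u c gam = (T u)%:E.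
  move=> /andP[au uc]; rewrite /T fineK// ge0_fin_numE ?path_length_ge0//.
  apply: le_lt_trans (ltry L); apply: le_trans len; exact: path_length_le_right.
exists s, T; split.
- by rewrite /s path_lengthxx.
- by rewrite /T path_lengthxx.
- move=> u auc; have /andP[au uc] := auc; split; [exact: sE|exact: TE| |].
    rewrite -!lee_fin -sE// path_length_ge0//=; apply: le_trans len.
    exact: path_length_le_left.
  rewrite -!lee_fin -TE// path_length_ge0//=; apply: le_trans len.
  exact: path_length_le_right.
- move=> u v au uv vc; rewrite -lee_fin EFinD -!sE; [|lra|lra].
  apply: le_trans (path_lengthD_le gam au uv); apply: leeD2l.
  exact: mdist_le_path_length.
- move=> u v au uv vc; rewrite -lee_fin EFinD -!TE; [|lra|lra].
  rewrite addeC; apply: le_trans (path_lengthD_le gam uv vc); apply: leeD2r.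
  exact: mdist_le_path_length.
Qed.

Lemma uniform_arc (R : realType) (X : metricType R) (b B : R) (D : set X) x y :
  uniform b D -> b <= B -> boundary D !=set0 -> D x -> D y ->
  exists a c gam (s T : R -> R),
    [/\ arc_joining D x y a c gam, s a = 0, T c = 0 &
    [/\ forall u, a <= u <= c ->
      [/\ 0 <= s u <= B * mdist x y, 0 <= T u <= B * mdist x y &
          Order.min (s u) (T u) <= B * bdist D (gam u)],
    forall u v, a <= u -> u <= v -> v <= c ->
      s u + mdist (gam u) (gam v) <= s v &
    forall u v, a <= u -> u <= v -> v <= c ->
      T v + mdist (gam u) (gam v) <= T u]].
Proof.
move=> [_ _ unif] bB bD Dx Dy.
have [a [c [gam [arc _ cigar len]]]] := unif x y Dx Dy.
have ac : a <= c by case: arc.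
have {}len : (path_length a c gam <= (B * mdist x y)%:E)%E.
  by apply: le_trans len _; rewrite lee_fin ler_wpM2r// mdist_ge0.
have [s [T [sa Tc sT sP TP]]] := finite_length_functions ac len.
exists a, c, gam, s, T; split=> //; split=> // u auc.
have [sE TE ? ?] := sT u auc; split=> //.
have := cigar u; rewrite in_itv/= => /(_ auc).
rewrite sE TE -EFin_min lee_fin => /le_trans; apply.
by rewrite ler_wpM2r// bdist_ge0.
Qed.

Section UniformImage.
Context {R : realType} (X : completeMetricType R) (Y : metricType R).
Context (cX cY b B C1 K eps tau : R) (m : nat).
Context (D : set X) (f : X -> Y) (g : Y -> X).

(** Roles of the constants: [C1] bounds the image of the whole arc by [|f x - f y|]; [K] compares
    image distances with the distance to the boundary of the image; [eps] is the step ratio of the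
    subdivision; [tau] and [m] control the geometric sums. *)
Lemma uniform_image_arc (x y : X) :
  quasiconvex cX [set: X] -> quasiconvex cY [set: Y] ->
  uniform b D -> b <= B -> 1 <= B -> boundary D !=set0 ->
  open (f @` D) -> boundary (f @` D) !=set0 ->
  {within D, continuous f} -> {in D, cancel f g} ->
  (forall e, 0 < e -> exists2 t, 0 < t & distortion_le t e (f @` D) g) ->
  distortion_le B C1 D f ->
  distortion_le (2 * cX * (2 * B)) K D f -> 0 < K ->
  distortion_le (2 * cX * eps) (2 * cY ^+ 2)^-1 D f -> 0 < eps ->
  distortion_le tau 2^-1 D f -> 0 < tau ->
  (0 < m)%N -> 1 <= tau / B * (1 + eps / B) ^+ m ->
  D x -> D y ->
  exists a c gam,
  [/\ arc_joining (f @` D) (f x) (f y) a c gam,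
    (path_length a c gam <= ((8 * m%:R + 2) * cY * C1 * mdist (f x) (f y))%:E)%E &
    forall u, u \in `[a, c] ->
      (Order.min (path_length a u gam) (path_length u c gam) <=
       (2 * (8 * cY * m%:R * K + 1) * bdist (f @` D) (gam u))%:E)%E].
Proof.
move=> qcX qcY unif bB B1 bD ofD bfD cf fK decg dC1 dK K0 deps eps0 dtau tau0 m0 mP Dx Dy.
have [[oD _ _] _ _] := unif.
have cX1 : 1 <= cX by case: qcX.
have cY1 : 1 <= cY by case: qcY.
have B0 : 0 < B by lra.
have qcD : quasiconvex B D.
  split=> // u v Du Dv; case: unif => _ _ /(_ u v Du Dv)[a [c [gam [arc _ _ len]]]].
  exists a, c, gam; split=> //; apply: le_trans len _.
  by rewrite lee_fin ler_wpM2r// mdist_ge0.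
have [a [c [gam [s [T [arc sa Tc [sTP sP TP]]]]]]] := uniform_arc unif bB bD Dx Dy.
case: (arc) => ac cg _ Dg [gx gy].
have {}Dg u : a <= u <= c -> D (gam u) by move=> ?; apply: Dg; rewrite in_itv.
pose del u := bdist D (gam u).
(* A positive lower bound for [del] makes the subdivision finite. With [o] the endpoint nearer in
   arc length, [bdist D o <= (B + 1) * del u <= 2 * B * del u]. *)
pose d0 := Order.min (bdist D x) (bdist D y) / (2 * B).
have d00 : 0 < d0 by rewrite divr_gt0 ?lt_min ?bdist_gt0//; lra.
have deld u : a <= u <= c -> d0 <= del u.
  move=> auc; have /andP[au uc] := auc; have [su Tu mu] := sTP u auc.
  rewrite /d0 ler_pdivrMr; last lra.
  have su' := sP a u (lexx _) au uc; rewrite sa gx add0r in su'.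
  have Tu' := TP u c au uc (lexx _); rewrite Tc gy add0r in Tu'.
  have lx := bdist_lipschitz x (gam u) bD.
  have ly := bdist_lipschitz y (gam u) bD.
  rewrite (metric_sym y) in ly.
  have dB : bdist D (gam u) <= B * bdist D (gam u).
    by rewrite ler_peMl// bdist_ge0.
  rewrite /del ge_min; apply/orP; move: mu; rewrite ge_min => /orP[h|h]; [left|right]; lra.
have [|u auc|//||N [t [t0 tN tP tE]]] :=
  @greedy_subdivision _ X a c (eps * d0) gam (fun u => eps * del u) T ac cg.
- by rewrite mulr_gt0.
- by rewrite ler_wpM2l ?deld// ltW.
- by rewrite Tc.
have tmono i j : (i <= j <= N.+1)%N -> t i <= t j.
  move=> /andP[]; elim: j => [|j IH]; first by rewrite leqn0 => /eqP ->.
  rewrite leq_eqVlt => /orP[/eqP ->//|ij] jN.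
  by apply: le_trans (IH _ _) _ => //; [exact: ltnW|have [] := tP j jN].
have tac j : (j <= N.+1)%N -> a <= t j <= c.
  by move=> jN; rewrite -{1}t0 -tN !tmono ?leqnn ?jN.
pose v j := gam (t j); pose p j := f (v j).
have Dv j : (j <= N.+1)%N -> D (v j) by move=> /tac; exact: Dg.
have near_p tt C j w : 0 <= tt -> 0 < C -> distortion_le (2 * cX * tt) C D f ->
    (j <= N.+1)%N -> D w -> mdist (v j) w <= tt * del (t j) ->
    mdist (p j) (f w) <= C * bdist (f @` D) (p j).
  move=> tt0 C0 dC jN Dw.
  exact: (mdist_image_le_bdist qcX oD bD ofD bfD cf fK decg tt0 C0 dC (Dv _ jN) Dw).
have bp j : 0 <= bdist (f @` D) (p j) by exact: bdist_ge0.
have cY2 : 0 < 2 * cY ^+ 2 by nra.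
(* One factor [cY] pays for the length of the joining arc, the other for showing that this arc stays
   in the image. *)
have smallp j : (j <= N)%N ->
    cY * (cY * mdist (p j) (p j.+1)) <= bdist (f @` D) (p j) / 2.
  move=> jN; have [_ _ _ vv] := tP j jN.
  have := near_p eps _ j (v j.+1) (ltW eps0) _ deps (leqW jN) (Dv _ _) vv.
  rewrite invr_gt0 => /(_ cY2 jN); rewrite ler_pdivlMl// -/(p j.+1).
  by lra.
pose l j := cY * mdist (p j) (p j.+1).
have l0 j : 0 <= l j by rewrite mulr_ge0 ?mdist_ge0//; lra.
have smalll j : (j <= N)%N -> l j <= bdist (f @` D) (p j) / 2.
  move=> /smallp; apply: le_trans; rewrite -/(l j) ler_peMl//.
(* The [j]-th arc stays where the boundary distance is at least half of that at [p j]. *)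
have [||ga [gc [gam' [arc' pts]]]] := @arc_chain _ Y (f @` D)
  (fun j => [set q | (f @` D) q /\
     bdist (f @` D) (p j) <= 2 * bdist (f @` D) q]) p l N.
- by move=> j _ q [].
- move=> j jN; case: (qcY) => _ /(_ (p j) (p j.+1) I I).
  move=> [a' [c' [h [[ac' ch ih _ [hp hp']] lenh]]]].
  exists a', c', h; split => //; split=> // u; rewrite in_itv/= => /andP[au uc].
  have pq : mdist (p j) (h u) <= l j.
    rewrite -lee_fin; apply: le_trans lenh; rewrite -hp.
    by apply: le_trans (mdist_le_path_length h au) (path_length_le_left _ au uc).
  have DP : (f @` D) (p j) by apply: imageP; apply: Dv; exact: leqW.
  split.
    apply: contrapT => nq; have h1 := bdist_le_outside qcY ofD DP nq.
    have h2 : cY * mdist (p j) (h u) <= cY * l j by rewrite ler_wpM2l//; lra.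
    have := smallp j jN; have := bdist_gt0 ofD DP bfD.
    rewrite -/(l j); lra.
  have := bdist_lipschitz (p j) (h u) bfD; have := smalll j jN; lra.
have kap0 : 0 < eps / B by rewrite divr_gt0.
have reachx rho : 0 <= rho <= mdist x y -> exists2 w, D w & mdist x w = rho.
  exact: quasiconvex_sphere qcD Dx Dy.
have reachy rho : 0 <= rho <= mdist x y -> exists2 w, D w & mdist y w = rho.
  by rewrite metric_sym; exact: quasiconvex_sphere qcD Dy Dx.
have st j : (j <= N.+1)%N -> [/\ 0 <= s (t j) <= B * mdist x y,
    0 <= T (t j) <= B * mdist x y &
    Order.min (s (t j)) (T (t j)) <= B * del (t j)].
  by move=> /tac/sTP.
have smono i j : (i <= j <= N.+1)%N -> s (t i) <= s (t j).
  move=> ijN; have tij := tmono i j ijN; have /andP[ij jN] := ijN.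
  have /andP[ai _] := tac i (leq_trans ij jN); have /andP[_ jc] := tac j jN.
  have := sP _ _ ai tij jc; have := mdist_ge0 (gam (t i)) (gam (t j)); lra.
have Tmono i j : (i <= j <= N.+1)%N -> T (t j) <= T (t i).
  move=> ijN; have tij := tmono i j ijN; have /andP[ij jN] := ijN.
  have /andP[ai _] := tac i (leq_trans ij jN); have /andP[_ jc] := tac j jN.
  have := TP _ _ ai tij jc; have := mdist_ge0 (gam (t i)) (gam (t j)); lra.
have xv j : (j <= N.+1)%N -> mdist x (v j) <= s (t j).
  move=> /tac/andP[aj jc]; have := sP a (t j) (lexx _) aj jc.
  by rewrite sa gx add0r.
have yv j : (j <= N.+1)%N -> mdist y (v j) <= T (t j).
  move=> /tac/andP[aj jc]; have := TP (t j) c aj jc (lexx _).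
  by rewrite Tc gy add0r metric_sym.
(* While [s <= T], the cigar condition gives [s <= B * del]; a step of size [eps * del] therefore
   multiplies [s] by at least [1 + eps / B]. *)
have xside k P : (k <= N)%N -> s (t k) <= T (t k) ->
    (forall w, D w -> mdist x w <= s (t k) -> mdist (f x) (f w) <= P) ->
    \sum_(0 <= j < k) l j <= cY * (4 * m%:R * P).
  move=> kN sTk PP; rewrite -mulr_sumr; apply: ler_wpM2l; first by lra.
  apply: (sum_mdist_step_le dtau tau0 B1 (ltW kap0) m0 mP Dx reachx (sig := fun j => s (t j))) => //.
  - by move=> j jk; have jN := leq_trans jk (leqW kN); split; [exact: Dv|exact: xv].
  - move=> j jk; have jN : (j < N)%N := leq_trans jk kN.
    have [aj jj jc _] := tP j (ltnW jN).
    have := sP _ _ aj jj jc; rewrite tE//.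
    have [s0 T0] := st j (leqW (ltnW jN)).
    have sTj : s (t j) <= T (t j).
      apply: le_trans (smono j k _) _; first by rewrite ltnW//= leqW.
      by apply: le_trans sTk _; apply: Tmono; rewrite ltnW//= leqW.
    rewrite min_l// => sB.
    have : eps / B * s (t j) <= eps * del (t j).
      rewrite -mulrA ler_wpM2l ?(ltW eps0)// mulrC ler_pdivrMr//; lra.
    lra.
  - by have [/andP[]] := st k (leqW kN).
(* The same argument from [y], with indices reversed by [N.+1 - i]. *)
have yside k P : (k <= N.+1)%N -> T (t k) <= s (t k) ->
    (forall w, D w -> mdist y w <= T (t k) -> mdist (f y) (f w) <= P) ->
    \sum_(k <= j < N.+1) l j <= cY * (4 * m%:R * P).
  move=> kN Tsk PP; rewrite -mulr_sumr; apply: ler_wpM2l; first by lra.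
  rewrite -[k in leLHS]add0n big_addn big_nat_rev add0n.
  rewrite (_ : \sum_(0 <= i < N.+1 - k) _ = \sum_(0 <= i < N.+1 - k)
      mdist (f (v (N.+1 - i)%N)) (f (v (N.+1 - i.+1)%N))); last first.
    apply: eq_big_nat => i /andP[_ ik]; rewrite metric_sym /p.
    have -> : (N.+1 - k - i.+1 + k = N.+1 - i.+1)%N by clear -ik; lia.
    by have -> : ((N.+1 - i.+1).+1 = N.+1 - i)%N by clear -ik; lia.
  apply: (sum_mdist_step_le dtau tau0 B1 (ltW kap0) m0 mP Dy reachy
    (sig := fun i => T (t (N.+1 - i)%N)) (v := fun i => v (N.+1 - i)%N)) => //.
  - by move=> i ik; split; [apply: Dv|apply: yv]; exact: leq_subr.
  - move=> i ik; pose j := (N.+1 - i.+1)%N.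
    have -> : (N.+1 - i = j.+1)%N by rewrite /j; clear -ik; lia.
    rewrite -/j; have jN : (j <= N)%N by rewrite /j; clear; lia.
    have kj : (k <= j)%N by rewrite /j; clear -ik; lia.
    have [aj jj jc _] := tP j jN.
    have [_ /andP[Tj0 _]] := st j (leqW jN).
    (* The last step may be short, but it ends at [y], where [T] vanishes, so growth is trivial
       there. *)
    have [jN'|jN'] := ltnP j N; last first.
      have jE : j = N by apply/eqP; rewrite eqn_leq jN.
      by rewrite jE tN Tc mulr0; move: Tj0; rewrite jE.
    have := TP _ _ aj jj jc; rewrite tE//.
    have Tsj : T (t j) <= s (t j).
      apply: le_trans (Tmono k j _) _; first by rewrite kj leqW.
      by apply: le_trans Tsk _; apply: smono; rewrite kj leqW.
    move=> step_j; rewrite min_r// => TB.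
    have : eps / B * T (t j) <= eps * del (t j).
      rewrite -mulrA ler_wpM2l ?(ltW eps0)// mulrC ler_pdivrMr//; lra.
    have [_ /andP[Tj1 _] _] := st j.+1 jN.
    have : eps / B * T (t j.+1) <= eps / B * T (t j).
      apply: ler_wpM2l; first exact: ltW.
      by apply: Tmono; rewrite leqnSn.
    lra.
  - by rewrite subKn//; have [_ /andP[]] := st k kN.
  - by move=> w Dw; rewrite subKn//; exact: PP.
have side_bound j o sig : (j <= N.+1)%N -> D o -> mdist o (v j) <= sig ->
    sig <= B * del (t j) -> forall w, D w -> mdist o w <= sig ->
    mdist (f o) (f w) <= 2 * K * bdist (f @` D) (p j).
  move=> jN Do ov sB w Dw ow.
  have BB : 0 <= 2 * B by lra.
  have vo := metric_triangle (v j) o w; rewrite (metric_sym (v j) o) in vo.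
  have := mdist_ge0 o w; move=> ow0.
  have h1 := near_p (2 * B) K j w BB K0 dK jN Dw ltac:(lra).
  have h2 := near_p (2 * B) K j o BB K0 dK jN Do ltac:(rewrite metric_sym; lra).
  have := metric_triangle (f o) (p j) (f w); rewrite (metric_sym (f o) (p j)).
  lra.
have L0 : 0 <= 8 * cY * m%:R * K + 1.
  by rewrite addr_ge0// !mulr_ge0// ltW//; lra.
have jbound (j : nat) q : (j <= N)%N -> bdist (f @` D) (p j) <= 2 * bdist (f @` D) q ->
    (8 * cY * m%:R * K + 1) * bdist (f @` D) (p j) <=
    2 * (8 * cY * m%:R * K + 1) * bdist (f @` D) q.
  by move=> jN pq; rewrite (mulrC 2) -[leRHS]mulrA; apply: ler_wpM2l.
exists ga, gc, gam'; split.
- by move: arc'; rewrite /p /v t0 tN gx gy.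
- have gac : ga <= gc by case: arc'.
  have [|j [jN _ lenl _]] := pts gc; first by rewrite gac lexx.
  apply: le_trans lenl _; rewrite lee_fin.
  apply: (@le_trans _ _ (\sum_(0 <= i < N.+1) l i)).
    by rewrite [leRHS](@big_cat_nat _ _ _ j.+1)//= lerDl sumr_ge0.
  (* The last index [k] with [s <= T] splits the chain into an [x] side, the single arc [l k], and a
     [y] side. *)
  pose Q k := (k <= N)%N && (s (t k) <= T (t k)).
  have Q0 : exists k, Q k.
    exists 0%N; rewrite /Q /= t0 sa; have [|_ /andP[]] := st 0%N; first by [].
    by rewrite t0.
  have QN k : Q k -> (k <= N)%N by case/andP.
  have [k /andP[kN sTk] kmax] := ex_maxnP Q0 QN.
  have kN1 : (k.+1 <= N.+1)%N := kN.
  have Tsk : T (t k.+1) <= s (t k.+1).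
    have [kN'|Nk] := ltnP k N.
      rewrite leNgt; apply/negP => sT.
      by have := kmax k.+1; rewrite /Q kN' ltW// ltnn => /(_ isT).
    have -> : k = N by apply/eqP; rewrite eqn_leq kN.
    by rewrite tN Tc -tN; have [|/andP[]] := st N.+1.
  pose P := C1 * mdist (f x) (f y).
  have Px w : D w -> mdist x w <= B * mdist x y -> mdist (f x) (f w) <= P.
    by move=> Dw; exact: dC1.
  have Py w : D w -> mdist y w <= B * mdist x y -> mdist (f y) (f w) <= P.
    move=> Dw; rewrite (metric_sym x) /P (metric_sym (f x)) => xw.
    exact: dC1.
  have sB j' : (j' <= N.+1)%N -> s (t j') <= B * mdist x y.
    by move=> /st[/andP[]].
  have TB j' : (j' <= N.+1)%N -> T (t j') <= B * mdist x y.
    by move=> /st[_ /andP[]].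
  have h1 := xside k P kN sTk
    (fun w Dw xw => Px w Dw (le_trans xw (sB k (leqW kN)))).
  have h2 := yside k.+1 P kN1 Tsk
    (fun w Dw yw => Py w Dw (le_trans yw (TB k.+1 kN1))).
  have h3 : l k <= cY * (2 * P).
    apply: ler_wpM2l; first by lra.
    apply: le_trans (metric_triangle _ (f x) _) _.
    rewrite (metric_sym (p k)).
    have := Px _ (Dv k (leqW kN)) (le_trans (xv _ (leqW kN)) (sB k (leqW kN))).
    have := Px _ (Dv k.+1 kN1) (le_trans (xv _ kN1) (sB k.+1 kN1)).
    rewrite -/(p k) -/(p k.+1); lra.
  rewrite (@big_cat_nat _ _ _ k)//=; last exact: leqW.
  rewrite [X in _ + X]big_ltn//.
  rewrite (_ : (8 * m%:R + 2) * cY * C1 * mdist (f x) (f y) =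
    cY * (4 * m%:R * P) + (cY * (2 * P) + cY * (4 * m%:R * P))); last first.
    by rewrite /P; ring.
  by rewrite lerD// lerD.
move=> u; rewrite in_itv/= => /pts[j [jN [_ pq] lenl lenr]].
(* The shorter side of [t j] in the original arc decides which part of the image path is estimated;
   the factor 2 comes from passing from [p j] to [gam' u]. *)
rewrite ge_min; apply/orP.
have [sT|Ts] := leP (s (t j)) (T (t j)); [left|right].
  apply: le_trans lenl _; rewrite lee_fin; apply: le_trans (jbound j _ jN pq).
  rewrite big_nat_recr//=.
  have [_ _] := st j (leqW jN); rewrite min_l// => sB.
  have := xside j _ jN sT (side_bound j x _ (leqW jN) Dx (xv j (leqW jN)) sB).
  have := smalll j jN; have := bp j; lra.
apply: le_trans lenr _; rewrite lee_fin; apply: le_trans (jbound j _ jN pq).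
have [_ _] := st j (leqW jN); rewrite min_r ?(ltW Ts)// => TB.
have := yside j _ (leqW jN) (ltW Ts) (side_bound j y _ (leqW jN) Dy (yv j (leqW jN)) TB).
have := bp j; lra.
Qed.

End UniformImage.

Lemma homeomorphism_on_open_image (R : realType) (X Y : metricType R)
    (G : set X) (G' : set Y) (f : X -> Y) (g : Y -> X) (D : set X) :
  homeomorphism_on G G' f g -> open G' -> D `<=` G -> open D ->
  open (f @` D).
Proof.
move=> [[fG _ fsurj] fK _ cg] oG' DG oD; rewrite openE => _ [x Dx <-].
have G'fx : G' (f x) by apply: fG; exact: DG.
have gf z : G z -> g (f z) = z by move=> Gz; rewrite fK ?inE.
have /nbhs_ballP[e1 /= e10 G'e] := open_nbhs_nbhs (conj oG' G'fx).
have /nbhs_ballP[e2 /= e20 De] := open_nbhs_nbhs (conj oD Dx).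
have [d d0 gd] := (within_continuous_ballP G' g).1 cg (f x) G'fx e2 e20.
apply/nbhs_ballP; exists (Order.min e1 d); first by rewrite /= lt_min e10.
move=> y; rewrite ballEmdist /= lt_min => /andP[y1 yd].
have G'y : G' y by apply: G'e; rewrite ballEmdist.
have [z Gz zy] := fsurj y G'y.
exists z => //; apply: De; rewrite ballEmdist /=.
have := gd y G'y; rewrite ballEmdist => /(_ yd).
by rewrite -zy !gf//; exact: DG.
Qed.

Theorem theorem1 (R : realType) (cX cY c1 b H1 H2 : R) :
  exists b' : R,
    forall (X Y : completeMetricType R) (G : set X) (G' : set Y)
           (f : X -> Y) (g : Y -> X) (D : set X),
      quasiconvex cX [set: X] ->
      quasiconvex cY [set: Y] ->
      domain G -> G `<` [set: X] ->
      domain G' -> G' `<` [set: Y] -> quasiconvex c1 G' ->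
      homeomorphism_on G G' f g ->
      weakly_quasisymmetric H1 G f ->
      weakly_quasisymmetric H2 G' g ->
      D `<=` G -> uniform b D ->
      uniform b' (f @` D).
Proof.
(* If [cX] or [cY] is below 1, quasiconvexity fails and any value of [b'] will do. *)
have [/andP[cX1 cY1]|nc] := boolP ((1 <= cX) && (1 <= cY)); last first.
  exists 0 => X Y G G' f g D [cX1 _] [cY1 _].
  by rewrite cX1 cY1 in nc.
pose B := Order.max b 1.
have bB : b <= B by rewrite le_max lexx.
have B1 : 1 <= B by rewrite le_max lexx orbT.
have [C1 C10 fC1] := weakly_quasisymmetric_distortion_le H1 B B.
have [K K0 fK] := weakly_quasisymmetric_distortion_le H1 B (2 * cX * (2 * B)).
have [Ce Ce0 gCe] := weakly_quasisymmetric_distortion_le H2 c1 (2 * cY ^+ 2).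
have [Ct Ct0 gCt] := weakly_quasisymmetric_distortion_le H2 c1 2.
(* Chosen so that [2 * cX * eps] is the scale at which the bound [Ce] for [g] makes [f] contract by
   [2 * cY ^+ 2]; [tau] likewise makes [f] halve distances. *)
pose eps := (Ce + 1)^-1 / (2 * cX).
have eps0 : 0 < eps by rewrite divr_gt0 ?invr_gt0; lra.
pose tau := (Ct + 1)^-1.
have tau0 : 0 < tau by rewrite invr_gt0; lra.
have [||m m0 mP] := @exists_geometric_exponent R (eps / B) (tau / B).
- by rewrite divr_gt0//; lra.
- by rewrite divr_gt0//; lra.
pose b1 := (8 * m%:R + 2) * cY * C1; pose b2 := 2 * (8 * cY * m%:R * K + 1).
exists (Order.max b1 b2).
move=> X Y G G' f g D qcX qcY [oG _ _] GT [oG' _ _] G'T qcG' hom wf wg DG unif.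
have [[oD D0 connD] DT unifD] := unif.
have [[fG _ _] gfK cf _] := hom.
have bD := boundary_neq0 qcX oD D0 DT.
have ofD := homeomorphism_on_open_image hom oG' DG oD.
have fDG' : f @` D `<=` G' by move=> _ [x Dx <-]; apply: fG; exact: DG.
have fDT : f @` D `<` [set: Y].
  by split=> // TfD; case: G'T => _; apply; exact: subset_trans TfD fDG'.
have fD0 : f @` D !=set0 by case: D0 => x Dx; exists (f x); exact: imageP.
have bfD := boundary_neq0 qcY ofD fD0 fDT.
have {}gfK : {in D, cancel f g}.
  by move=> x; rewrite inE => Dx; apply: gfK; rewrite inE; exact: DG.
have {}cf : {within D, continuous f} by exact: continuous_subspaceW cf.
(* Uniformity makes [D] quasiconvex, so [f] can be controlled by chaining inside [D]. *)
have qcD : quasiconvex B D.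
  split=> // x y Dx Dy; have [s [t [gam [arc _ _ len]]]] := unifD x y Dx Dy.
  exists s, t, gam; split=> //; apply: le_trans len _.
  by rewrite lee_fin ler_wpM2r// mdist_ge0.
have wfD : weakly_quasisymmetric H1 D f.
  by move=> x u v Dx Du Dv; apply: wf; exact: DG.
have gD t C : distortion_le t C G' g -> distortion_le t C (f @` D) g.
  by move=> gG x u v Dx Du Dv; apply: gG; exact: fDG'.
have fD' x : D x -> (f @` D) (f x) by exact: imageP.
(* Here [f] and [g] swap roles: distortion of [f] at the large scale [e^-1] forces small distortion
   of [g]. *)
have decg e : 0 < e -> exists2 t, 0 < t & distortion_le t e (f @` D) g.
  move=> e0; have [C C0 fC] := weakly_quasisymmetric_distortion_le H1 B e^-1.
  exists (C + 1)^-1; first by rewrite invr_gt0; lra.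
  rewrite -[e]invrK; apply: (@inverse_distortion_le _ _ _ _ _ _ D _ f).
  - by rewrite invr_gt0.
  - exact: ltW.
  - by move=> _ [x Dx <-]; rewrite gfK ?inE.
  - by move=> y; rewrite inE => -[x Dx <-]; rewrite gfK ?inE.
  - exact: fC.
have deps : distortion_le (2 * cX * eps) (2 * cY ^+ 2)^-1 D f.
  have -> : 2 * cX * eps = (Ce + 1)^-1 by rewrite /eps mulrC divfK//; lra.
  apply: (inverse_distortion_le _ (ltW Ce0) fD' gfK (gD _ _ (gCe _ _ _ _ qcG' wg))).
  by nra.
have dtau : distortion_le tau 2^-1 D f.
  exact: (inverse_distortion_le _ (ltW Ct0) fD' gfK (gD _ _ (gCt _ _ _ _ qcG' wg))).
have b1b : b1 <= Order.max b1 b2 by rewrite le_max lexx.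
have b2b : b2 <= Order.max b1 b2 by rewrite le_max lexx orbT.
split=> //.
  by split=> //; exact: connected_continuous_connected.
move=> _ _ [x Dx <-] [y Dy <-].
have [s [t [gam [arc len cigar]]]] := uniform_image_arc qcX qcY unif bB B1 bD
  ofD bfD cf gfK decg (fC1 _ _ _ _ qcD wfD) (fK _ _ _ _ qcD wfD) K0 deps eps0
  dtau tau0 m0 mP Dx Dy.
have {}len : (path_length s t gam <= (Order.max b1 b2 * mdist (f x) (f y))%:E)%E.
  by apply: le_trans len _; rewrite lee_fin ler_wpM2r// mdist_ge0.
exists s, t, gam; split=> //.
  exact: le_lt_trans len (ltry _).
move=> u /cigar/le_trans; apply; rewrite lee_fin ler_wpM2r// bdist_ge0//.
Qed.
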